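(* Let $\mathcal H_A,\mathcal H_B$ be finite-dimensional complex Hilbert spaces, $d_A=\dim\mathcal H_A$, and let $\Lambda=(\lambda_1,\dots,\lambda_{d_A})$ be a nondegenerate spectrum, i.e. the $\lambda_i$ are pairwise distinct real numbers. Let $\mathcal U_A^\Lambda$ denote the local quantum uncertainty. Then for every density matrix $\rho$ on $\mathcal H_A\otimes\mathcal H_B$: (i) (Invariance under local unitaries) $\mathcal U_A^\Lambda\big((U_A\otimes U_B)\rho(U_A\otimes U_B)^\dagger\big)=\mathcal U_A^\Lambda(\rho)$ for all unitaries $U_A$ on $\mathcal H_A$ and $U_B$ on $\mathcal H_B$. (ii) (Monotonicity under local operations on $B$) $\mathcal U_A^\Lambda\big((\mathrm{id}_A\otimes\Phi_B)(\rho)\big)\le \mathcal U_A^\Lambda(\rho)$ for every completely positive trace-preserving map $\Phi_B$ on operators on $\mathcal H_B$. (iii) (Faithfulness) $\mathcal U_A^\Lambda(\rho)=0$ if and only if $\rho$ has zero discord with respect to measurements on $A$, i.e. $\rho=\sum_i p_i\,|i\rangle\langle i|_A\otimes\tau_i$ for some orthonormal basis $\{|i\rangle\}$ of $\mathcal H_A$, some probability distribution $(p_i)$ and some density matrices $\tau_i$ on $\mathcal H_B$.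
   Context: For a density matrix $\rho$ and a Hermitian operator $K$ on the same space, the Wigner-Yanase skew information is $\mathcal I(\rho,K)=-\tfrac12\mathrm{Tr}\{[\rho^{1/2},K]^2\}$. For a bipartite state $\rho$ on $\mathcal H_A\otimes\mathcal H_B$ and a nondegenerate spectrum $\Lambda$, the local quantum uncertainty is $\mathcal U_A^\Lambda(\rho)=\min_{K_A}\mathcal I(\rho,K_A\otimes\mathbb I_B)$, where the minimum is over all Hermitian operators $K_A$ on $\mathcal H_A$ with spectrum $\Lambda$, i.e. $K_A=V\,\mathrm{diag}(\Lambda)\,V^\dagger$ with $V$ unitary. *)

(* Defs.v *)
From HB Require Import structures.
From mathcomp Require Import all_boot all_order all_algebra spectral sesquilinear.
From mathcomp Require Import boolp classical_sets reals.
From mathcomp Require Import complex mxtens.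

Set Implicit Arguments.
Unset Strict Implicit.
Unset Printing Implicit Defensive.

Import Order.TTheory GRing.Theory Num.Theory.

Local Open Scope ring_scope.
Local Open Scope complex_scope.
Local Open Scope sesquilinear_scope.

(* A Hilbert space of dimension n is C^n with C = R[i], and its operators are  *)
(* 'M[R[i]]_n. The tensor product of C^m and C^n is C^(m * n), whose basis     *)
(* vector (i, a) has index mxtens_index (i, a), so that the tensor product of  *)
(* operators is the Kronecker product *t.                                      *)

(* In R[i], 0 <= z means that z is real and nonnegative. *)
Definition psdmx (R : realType) (n : nat) (A : 'M[R[i]]_n) : Prop :=
  A \is hermsymmx /\ forall v : 'cV[R[i]]_n, 0 <= (v^t* *m A *m v) 0 0.

Definition density (R : realType) (n : nat) (rho : 'M[R[i]]_n) : Prop :=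
  psdmx rho /\ \tr rho = 1.

(* Spectral calculus: for A Hermitian, spectralmx A is unitary and             *)
(* A = (spectralmx A)^t* *m diag_mx (spectral_diag A) *m spectralmx A.         *)
Definition sqrtmx (R : realType) (n : nat) (A : 'M[R[i]]_n) : 'M[R[i]]_n :=
  (spectralmx A)^t* *m diag_mx (map_mx sqrtC (spectral_diag A))
    *m spectralmx A.

Definition commutator (R : realType) (n : nat) (A B : 'M[R[i]]_n) :
  'M[R[i]]_n := A *m B - B *m A.

(* For rho positive semidefinite and K Hermitian, the commutator is            *)
(* anti-Hermitian, so that the trace is real and Re loses nothing.             *)
Definition skew_info (R : realType) (n : nat) (rho K : 'M[R[i]]_n) : R :=
  - (2^-1 * complex.Re (\tr (commutator (sqrtmx rho) K
                               *m commutator (sqrtmx rho) K))).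

Definition with_spectrum (R : realType) (n : nat) (L : 'rV[R]_n) :
    set 'M[R[i]]_n :=
  [set K | exists V : 'M[R[i]]_n, V \is unitarymx /\
     K = V *m diag_mx (map_mx (real_complex R) L) *m V^t*].

(* The least element of S (0 if there is none). *)
Definition minimum (R : realType) (S : set R) : R :=
  xget 0 (S `&` lbound S)%classic.

Definition lqu (R : realType) (dA dB : nat) (L : 'rV[R]_dA)
    (rho : 'M[R[i]]_(dA * dB)) : R :=
  minimum [set skew_info rho (K *t (1%:M : 'M[R[i]]_dB))
          | K in with_spectrum L]%classic.

(* The (i, j) block (<i| (x) 1) X (|j> (x) 1). *)
Definition blockmx (R : realType) (k n : nat) (i j : 'I_k)
    (X : 'M[R[i]]_(k * n)) : 'M[R[i]]_n :=
  \matrix_(a, b) X (mxtens_index (i, a)) (mxtens_index (j, b)).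

(* id_k (x) Phi, where X = \sum_(i, j) |i><j| (x) blockmx i j X. *)
Definition id_tens (R : realType) (k n : nat)
    (Phi : {linear 'M[R[i]]_n -> 'M[R[i]]_n}) (X : 'M[R[i]]_(k * n)) :
    'M[R[i]]_(k * n) :=
  \sum_(i < k) \sum_(j < k) (delta_mx i j : 'M[R[i]]_k) *t Phi (blockmx i j X).

Definition completely_positive (R : realType) (n : nat)
    (Phi : {linear 'M[R[i]]_n -> 'M[R[i]]_n}) : Prop :=
  forall (k : nat) (X : 'M[R[i]]_(k * n)), psdmx X -> psdmx (id_tens Phi X).

Definition trace_preserving (R : realType) (n : nat)
    (Phi : {linear 'M[R[i]]_n -> 'M[R[i]]_n}) : Prop :=
  forall X : 'M[R[i]]_n, \tr (Phi X) = \tr X.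

(* n orthonormal vectors of C^n. *)
Definition orthonormal_basis (R : realType) (n : nat)
    (e : 'I_n -> 'cV[R[i]]_n) : Prop :=
  forall i j, ((e i)^t* *m e j) 0 0 = (i == j)%:R.

Definition zero_discord (R : realType) (dA dB : nat)
    (rho : 'M[R[i]]_(dA * dB)) : Prop :=
  exists (e : 'I_dA -> 'cV[R[i]]_dA) (p : 'I_dA -> R)
         (tau : 'I_dA -> 'M[R[i]]_dB),
    [/\ orthonormal_basis e,
        (forall i, 0 <= p i) /\ \sum_i p i = 1,
        forall i, density (tau i)
      & rho = \sum_i (p i)%:C *: ((e i *m (e i)^t*) *t tau i)].

(* Main.v *)
From HB Require Import structures.
Require Import Defs.
From mathcomp Require Import all_boot all_order all_algebra spectral sesquilinear.
From mathcomp Require Import boolp classical_sets reals.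
From mathcomp Require Import complex mxtens.
From mathcomp Require Import topology normedtype derive.
From mathcomp Require Import ring.

(* Skew information is half the squared Hilbert-Schmidt norm of
   [rho^(1/2), K], and a continuous function on the compact unitary group
   attains its minimum, so the local quantum uncertainty vanishes iff rho
   commutes with some K_A (x) 1; as the spectrum is nondegenerate, this says
   that rho is block diagonal in the eigenbasis of K_A.

   Monotonicity is the Lieb-type inequality
     tr (X^+ A^(1/2) X A^(1/2)) <= tr (X^+ B^(1/2) X B^(1/2)),  B = Psi(A),
   for X fixed by the dual Psi' of the channel (^+ is the adjoint). By
   Cauchy-Schwarz and the Kadison-Schwarz inequality, the form
     Q(X, Y) = tr (A^(1/2) Psi'(X) A^(1/2) Psi'(Y)^+)
   satisfies |Q(X, Y)|^2 <= tr (B X X^+) tr (B Y^+ Y). Left and right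
   multiplication by B are commuting positive operators, diagonal in a common
   basis, so Q is bounded by their geometric mean X |-> B^(1/2) X B^(1/2),
   after perturbing B^(1/2) to B^(1/2) + e to make it invertible. *)

Set Implicit Arguments.
Unset Strict Implicit.
Unset Printing Implicit Defensive.

Import Order.TTheory GRing.Theory Num.Theory.
Import numFieldNormedType.Exports.
Local Open Scope ring_scope.
Local Open Scope complex_scope.
Local Open Scope sesquilinear_scope.

(** * Adjoints and the geometric mean bound *)

Section Adjoint.
Context {C : numClosedFieldType}.

Lemma adjmxM m n p (A : 'M[C]_(m, n)) (B : 'M_(n, p)) :
  (A *m B)^t* = B^t* *m A^t*.
Proof. by rewrite trmx_mul map_mxM. Qed.

Lemma adjmxD m n (A B : 'M[C]_(m, n)) : (A + B)^t* = A^t* + B^t*.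
Proof. by rewrite linearD map_mxD. Qed.

Lemma adjmxN m n (A : 'M[C]_(m, n)) : (- A)^t* = - A^t*.
Proof. by rewrite linearN map_mxN. Qed.

Lemma adjmxB m n (A B : 'M[C]_(m, n)) : (A - B)^t* = A^t* - B^t*.
Proof. by rewrite adjmxD adjmxN. Qed.

Lemma adjmx_sum m n (I : Type) (r : seq I) (P : pred I) (F : I -> 'M[C]_(m, n)) :
  (\sum_(i <- r | P i) F i)^t* = \sum_(i <- r | P i) (F i)^t*.
Proof.
elim/big_rec2: _ => [|i A B _ <-]; last by rewrite adjmxD.
by rewrite trmx0 map_mx0.
Qed.

Lemma adjmx1 n : (1%:M : 'M[C]_n)^t* = 1%:M.
Proof. by rewrite trmx1 map_mx1. Qed.

Lemma adjmx_tens m n p q (A : 'M[C]_(m, n)) (B : 'M[C]_(p, q)) :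
  (A *t B)^t* = A^t* *t B^t*.
Proof. by rewrite trmx_tens map_mxT. Qed.

Lemma hermsymmxP n (A : 'M[C]_n) : reflect (A^t* = A) (A \is hermsymmx).
Proof.
by apply: (iffP (is_hermitianmxP _ _ _)); rewrite expr0 scale1r => /esym.
Qed.

Lemma adjmx_diag_real n (d : 'rV[C]_n) :
  (forall i, d 0 i \is Num.real) -> (diag_mx d)^t* = diag_mx d.
Proof.
move=> dr; rewrite tr_diag_mx map_diag_mx; congr diag_mx.
by apply/rowP=> i; rewrite !mxE; apply/CrealP.
Qed.

Lemma mul_adjmx_unitary n (U : 'M[C]_n) : U \is unitarymx -> U^t* *m U = 1%:M.
Proof. by move=> /unitarymxP/mulmx1C. Qed.

Lemma normal_spectralE n (A : 'M[C]_n) : A \is normalmx ->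
  A = (spectralmx A)^t* *m diag_mx (spectral_diag A) *m spectralmx A.
Proof.
by move/orthomx_spectralP; rewrite invmx_unitary ?spectral_unitarymx.
Qed.

Lemma unitary_conj_normal n (U A : 'M[C]_n) :
  U \is unitarymx -> A \is normalmx -> U *m A *m U^t* \is normalmx.
Proof.
move=> /mul_adjmx_unitary Uu /normalmxP An; apply/normalmxP.
rewrite !adjmxM trmxCK !mulmxA -(mulmxA _ (U^t*) U) Uu mulmx1.
by rewrite -(mulmxA _ (U^t*) U) Uu mulmx1 -!mulmxA; congr (_ *m _); rewrite !mulmxA An.
Qed.

Lemma mxtrace_conj_unitary n (U A : 'M[C]_n) :
  U \is unitarymx -> \tr (U *m A *m U^t*) = \tr A.
Proof.
by move=> /mul_adjmx_unitary Uu; rewrite mxtrace_mulC mulmxA Uu mul1mx.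
Qed.

Lemma mxtrace_adj n (A : 'M[C]_n) : \tr (A^t*) = Num.conj (\tr A).
Proof. by rewrite trace_map_mx mxtrace_tr. Qed.

(** Identifies the Hilbert-Schmidt product with the standard one on vectorised matrices, so that
    Cauchy-Schwarz and matrices of sesquilinear forms can be used for operators. *)
Lemma dotmx_mxvec m n (A B : 'M[C]_(m, n)) :
  dotmx (mxvec A) (mxvec B) = \tr (A *m B^t*).
Proof.
rewrite dotmxE mxE (reindex _ (curry_mxvec_bij _ _)) /=.
transitivity (\sum_i \sum_j A i j * (B i j)^*).
  by rewrite pair_bigA; apply: eq_bigr => -[i j] _ /=; rewrite !mxE !mxvecE.
by apply: eq_bigr => i _; rewrite mxE; apply: eq_bigr => j _; rewrite !mxE.
Qed.

Lemma mxtrace_mul_adj_CS m n (A B : 'M[C]_(m, n)) :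
  `|\tr (A *m B^t*)| ^+ 2 <= \tr (A *m A^t*) * \tr (B *m B^t*).
Proof. by rewrite -!dotmx_mxvec CauchySchwarz. Qed.

Lemma mxtrace_mul_adjE m n (A : 'M[C]_(m, n)) :
  \tr (A *m A^t*) = \sum_i \sum_j `|A i j| ^+ 2.
Proof.
by apply: eq_bigr => i _; rewrite mxE; apply: eq_bigr => j _; rewrite !mxE normCK.
Qed.

Lemma mxtrace_mul_adj_ge0 m n (A : 'M[C]_(m, n)) : 0 <= \tr (A *m A^t*).
Proof.
by rewrite mxtrace_mul_adjE; do 2 ![apply: sumr_ge0 => ? _]; rewrite exprn_ge0.
Qed.

Lemma mxtrace_mul_adj_eq0 m n (A : 'M[C]_(m, n)) : \tr (A *m A^t*) = 0 -> A = 0.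
Proof.
rewrite mxtrace_mul_adjE => /eqP; rewrite psumr_eq0; last first.
  by move=> i _; apply: sumr_ge0 => ? _; rewrite exprn_ge0.
move=> /allP A0; apply/matrixP=> i j; rewrite mxE; apply/eqP.
have := A0 i (mem_index_enum _); rewrite psumr_eq0; last by move=> ? _; rewrite exprn_ge0.
by move=> /allP/(_ j (mem_index_enum _)); rewrite /= sqrf_eq0 normr_eq0.
Qed.

Lemma mulmx_diagE n (x : 'rV[C]_n) (d : 'rV[C]_n) :
  (x *m diag_mx d *m x^t*) 0 0 = \sum_k d 0 k * `|x 0 k| ^+ 2.
Proof.
rewrite mxE; apply: eq_bigr => k _; rewrite mul_mx_diag !mxE normCK.
by rewrite mulrAC mulrC.
Qed.

(* With E = diag (a b)^(-1/2), an eigenvector of E Q E gives w such that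
   w Q = d (a b) w; testing w against (a / b) w shows that the eigenvalue d is
   at most 1. *)
Lemma form_le_geometric_mean n (Q : 'M[C]_n) (a b : 'I_n -> C) :
  Q \is hermsymmx -> (forall k, 0 < a k) -> (forall k, 0 < b k) ->
  (forall x y : 'rV_n, `|(x *m Q *m y^t*) 0 0| ^+ 2 <=
     (\sum_k a k ^+ 2 * `|x 0 k| ^+ 2) * (\sum_k b k ^+ 2 * `|y 0 k| ^+ 2)) ->
  forall x : 'rV_n, (x *m Q *m x^t*) 0 0 <= \sum_k a k * b k * `|x 0 k| ^+ 2.
Proof.
move=> /hermsymmxP Qh a0 b0 Qab x.
pose g k := (sqrtC (a k * b k))^-1.
have g0 k : 0 < g k by rewrite invr_gt0 sqrtC_gt0 mulr_gt0.
have gK k : g k ^- 2 = a k * b k by rewrite exprVn invrK sqrtCK.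
pose e := \row_k g k; pose E := diag_mx e.
have Eh : E^t* = E by apply: adjmx_diag_real => i; rewrite mxE gtr0_real.
pose P := E *m Q *m E.
have Ph : P \is hermsymmx by apply/hermsymmxP; rewrite !adjmxM Eh Qh mulmxA.
have Pn := hermitian_normalmx Ph.
have Pe := normal_spectralE Pn; have Uu := spectral_unitarymx P.
set U := spectralmx P in Pe Uu; set d := spectral_diag P in Pe.
have dr k : d 0 k \is Num.real by have /mxOverP := hermitian_spectral_diag_real Ph.
have d1 k : d 0 k <= 1.
  pose w := row k U *m E.
  have wE i : w 0 i = U k i * g i by rewrite /w mul_mx_diag !mxE.
  have wQ i : (w *m Q) 0 i = d 0 k * (a i * b i) * w 0 i.
    have : (w *m Q *m E) 0 i = d 0 k * U k i.
      rewrite /w -!mulmxA (mulmxA E) -/P -row_mul Pe !mulmxA (unitarymxP Uu) mul1mx.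
      by rewrite [LHS]mxE mul_diag_mx mxE.
    rewrite mul_mx_diag mxE [e _ _]mxE => H; apply: (mulIf (lt0r_neq0 (g0 i))).
    by rewrite H wE -gK; field; exact: lt0r_neq0.
  pose y := \row_i (a i / b i * w 0 i).
  pose S := \sum_i a i ^+ 2 * `|w 0 i| ^+ 2.
  have Sge i : 0 <= a i ^+ 2 * `|w 0 i| ^+ 2 by rewrite mulr_ge0 ?exprn_ge0 // ltW.
  have S0 : 0 < S.
    rewrite lt0r sumr_ge0 // andbT; apply/negP => /eqP/eqP.
    rewrite psumr_eq0 // => /allP w0.
    have : (U *m U^t*) k k = 1 by rewrite (unitarymxP Uu) mxE eqxx.
    rewrite mxE big1 => [/eqP|i _]; first by rewrite eq_sym oner_eq0.
    have := w0 i (mem_index_enum _); rewrite /= mulf_eq0 !sqrf_eq0 normr_eq0 wE mulf_eq0.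
    by rewrite !(gt_eqF (a0 _)) (gt_eqF (g0 _)) orbF /= => /eqP ->; rewrite mul0r.
  have yS : \sum_i b i ^+ 2 * `|y 0 i| ^+ 2 = S.
    apply: eq_bigr => i _; rewrite mxE normrM (gtr0_norm (divr_gt0 _ _)) //.
    by field; exact: lt0r_neq0.
  have wQy : (w *m Q *m y^t*) 0 0 = d 0 k * S.
    rewrite mxE mulr_sumr; apply: eq_bigr => i _; rewrite wQ !mxE normCK rmorphM /=.
    rewrite (CrealP (gtr0_real (divr_gt0 (a0 i) (b0 i)))).
    by field; exact: lt0r_neq0.
  (* With this choice of [y] both weighted sums equal [S], so the hypothesis reads |d|^2 S^2 <= S^2,
     and [S] can be cancelled. *)
  have := Qab w y; rewrite wQy yS -/S normrM exprMn (gtr0_norm S0) -expr2.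
  rewrite ger_pMl ?exprn_gt0 // expr_le1 // real_ler_norml ?dr ?real1 //.
  by case/andP.
(* Put x = z E and expand z in the eigenbasis of [P] with coordinates [u]: the form becomes the sum
   of d |u|^2 and the bound becomes the sum of |u|^2, so d <= 1 concludes. *)
pose z := \row_k (x 0 k / g k).
have -> : x = z *m E.
  by apply/rowP=> k; rewrite mul_mx_diag !mxE divfK ?gt_eqF.
pose u := z *m U^t*.
have -> : z *m E *m Q *m (z *m E)^t* = u *m diag_mx d *m u^t*.
  rewrite adjmxM Eh -!mulmxA (mulmxA E) (mulmxA _ E) -/P Pe.
  by rewrite /u adjmxM trmxCK !mulmxA.
rewrite mulmx_diagE.
have -> : \sum_k a k * b k * `|(z *m E) 0 k| ^+ 2 = (z *m z^t*) 0 0.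
  rewrite mxE; apply: eq_bigr => k _; rewrite mul_mx_diag !mxE -gK -normCK.
  rewrite !normrM !exprMn (gtr0_norm (g0 k)).
  by field; exact: lt0r_neq0.
have -> : z *m z^t* = u *m u^t*.
  by rewrite adjmxM trmxCK mulmxA -(mulmxA z) (mul_adjmx_unitary Uu) mulmx1.
rewrite [leRHS]mxE; apply: ler_sum => k _.
by rewrite [u^t* _ _]mxE [u^T _ _]mxE -normCK ler_piMl ?exprn_ge0.
Qed.

End Adjoint.

(** * Positive square roots *)

Section PositiveMatrices.
Context {C : numClosedFieldType}.

(* [psdmx] and [sqrtmx] are the instances of [psd] and [msqrt] at [R[i]]. *)
Definition psd n (A : 'M[C]_n) : Prop :=
  A \is hermsymmx /\ forall v : 'cV[C]_n, 0 <= (v^t* *m A *m v) 0 0.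

Definition msqrt n (A : 'M[C]_n) : 'M[C]_n :=
  (spectralmx A)^t* *m diag_mx (map_mx sqrtC (spectral_diag A))
    *m spectralmx A.

(** The expanded skew information. Its first term is linear in [A], so that only the second one
    calls for a Lieb-type inequality. *)
Definition wy_skew n (A K : 'M[C]_n) : C :=
  \tr (A *m (K *m K)) - \tr (msqrt A *m K *m msqrt A *m K).

Lemma psd_herm n (A : 'M[C]_n) : psd A -> A^t* = A.
Proof. by case=> /hermsymmxP. Qed.

Lemma psd_normal n (A : 'M[C]_n) : psd A -> A \is normalmx.
Proof. by case=> /hermitian_normalmx. Qed.

Lemma psd_congr m n (A : 'M[C]_n) (B : 'M[C]_(m, n)) :
  psd A -> psd (B *m A *m B^t*).
Proof.
case=> /hermsymmxP Ah A0; split.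
  by apply/hermsymmxP; rewrite !adjmxM trmxCK Ah mulmxA.
by move=> v; have := A0 (B^t* *m v); rewrite adjmxM trmxCK !mulmxA.
Qed.

Lemma psd_mul_adj m n (A : 'M[C]_(m, n)) : psd (A *m A^t*).
Proof.
split; first by apply/hermsymmxP; rewrite adjmxM trmxCK.
move=> v; have := mxtrace_mul_adj_ge0 (v^t* *m A).
by rewrite /mxtrace big_ord1 adjmxM trmxCK !mulmxA.
Qed.

Lemma psd_spectral_diag_ge0 n (A : 'M[C]_n) k :
  psd A -> 0 <= spectral_diag A 0 k.
Proof.
move=> Apsd; have Ae := normal_spectralE (psd_normal Apsd).
have /unitarymxP Uu := spectral_unitarymx A.
have [_ /(_ ((spectralmx A)^t* *m delta_mx k 0))] := Apsd.
rewrite {2}Ae adjmxM trmxCK !mulmxA.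
rewrite -(mulmxA _ (spectralmx A)) Uu mulmx1 -(mulmxA _ (spectralmx A)) Uu mulmx1.
by rewrite -mulmxA -colE !mxE (bigD1 k) //= big1 ?addr0 => [|i /negPf ik];
   rewrite !mxE !eqxx ?ik ?mulr0n ?mulr0 ?mulr1n ?conjC1 ?mul1r ?mulr1.
Qed.

Lemma msqrt_sq n (A : 'M[C]_n) : A \is normalmx -> msqrt A *m msqrt A = A.
Proof.
move=> /normal_spectralE Ae; have /unitarymxP Uu := spectral_unitarymx A.
rewrite /msqrt !mulmxA -(mulmxA _ (spectralmx A)) Uu mulmx1.
rewrite -(mulmxA _ (diag_mx _) (diag_mx _)) mulmx_diag [RHS]Ae.
by congr (_ *m diag_mx _ *m _); apply/rowP=> i; rewrite !mxE -expr2 sqrtCK.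
Qed.

Lemma msqrt_herm n (A : 'M[C]_n) : psd A -> (msqrt A)^t* = msqrt A.
Proof.
move=> Apsd; rewrite /msqrt !adjmxM trmxCK adjmx_diag_real ?mulmxA // => i.
by rewrite mxE ger0_real // sqrtC_ge0 psd_spectral_diag_ge0.
Qed.

(** In eigenbases of [A] and [B] the hypothesis says that d_i M_ij = M_ij e_j, hence d_i = e_j
    wherever M_ij is nonzero, and there the square roots agree too. Commutation and unitary
    covariance of [msqrt] both follow, whatever eigenbasis [spectralmx] picks. *)
Lemma msqrt_intertwine n (A B W : 'M[C]_n) :
  A \is normalmx -> B \is normalmx -> A *m W = W *m B ->
  msqrt A *m W = W *m msqrt B.
Proof.
move=> /normal_spectralE Ae /normal_spectralE Be AW.
have /unitarymxP Uu := spectral_unitarymx A.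
have Uu' := mul_adjmx_unitary (spectral_unitarymx A).
have /unitarymxP Vu := spectral_unitarymx B.
have Vu' := mul_adjmx_unitary (spectral_unitarymx B).
rewrite /msqrt; move: Ae Be Uu Uu' Vu Vu'.
move: (spectralmx A) (spectral_diag A) (spectralmx B) (spectral_diag B).
move=> U d V e Ae Be Uu Uu' Vu Vu'.
pose M := U *m W *m V^t*.
have WM : W = U^t* *m M *m V.
  by rewrite /M !mulmxA Uu' mul1mx -mulmxA Vu' mulmx1.
have dM : diag_mx d *m M = M *m diag_mx e.
  have := congr1 (fun X => U *m X *m V^t*) AW.
  rewrite Ae Be /M !mulmxA Uu mul1mx => ->.
  by rewrite -!mulmxA Vu mulmx1.
clearbody M.
have sM : diag_mx (map_mx sqrtC d) *m M = M *m diag_mx (map_mx sqrtC e).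
  apply/matrixP=> i j; move/matrixP: dM => /(_ i j).
  rewrite !mul_diag_mx !mul_mx_diag !mxE.
  have [->|Mij] := eqVneq (M i j) 0; first by rewrite !mulr0 !mul0r.
  by rewrite mulrC => /(mulfI Mij) ->; rewrite mulrC.
rewrite WM !mulmxA -(mulmxA _ U) Uu mulmx1 -(mulmxA _ (diag_mx _)) sM.
by rewrite -(mulmxA _ V) Vu mulmx1 !mulmxA.
Qed.

Lemma psd_tr_ge0 n (A : 'M[C]_n) : psd A -> 0 <= \tr A.
Proof.
move=> Ap; rewrite -(msqrt_sq (psd_normal Ap)) -{2}(msqrt_herm Ap).
exact: mxtrace_mul_adj_ge0.
Qed.

Lemma psd_tr_eq0 n (A : 'M[C]_n) : psd A -> \tr A = 0 -> A = 0.
Proof.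
move=> Ap; rewrite -(msqrt_sq (psd_normal Ap)) -{2}(msqrt_herm Ap).
by move/mxtrace_mul_adj_eq0 => ->; rewrite mul0mx.
Qed.

Lemma mul_sqr_comm n (S K : 'M[C]_n) : S *m K = K *m S ->
  S *m S *m K = K *m (S *m S).
Proof. by move=> SK; rewrite -mulmxA SK !mulmxA SK. Qed.

Lemma msqrt_comm n (A K : 'M[C]_n) : A \is normalmx ->
  msqrt A *m K - K *m msqrt A = 0 <-> A *m K = K *m A.
Proof.
move=> An; split=> [/eqP|AK].
  rewrite subr_eq0 => /eqP SK; have := mul_sqr_comm SK.
  by rewrite msqrt_sq.
by apply/eqP; rewrite subr_eq0; apply/eqP; apply: msqrt_intertwine.
Qed.

Lemma comm_adj n (A B : 'M[C]_n) : A^t* = A -> B^t* = B ->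
  (A *m B - B *m A)^t* = - (A *m B - B *m A).
Proof. by move=> Ah Bh; rewrite adjmxB !adjmxM Ah Bh opprB. Qed.

Lemma tr_comm_sqr n (S K : 'M[C]_n) :
  - \tr ((S *m K - K *m S) *m (S *m K - K *m S)) =
  2 * (\tr (S *m S *m (K *m K)) - \tr (S *m K *m S *m K)).
Proof.
rewrite mulmxBl !mulmxBr !raddfB /= !mulmxA.
have -> : \tr (S *m K *m K *m S) = \tr (S *m S *m K *m K).
  by rewrite mxtrace_mulC !mulmxA.
have -> : \tr (K *m S *m S *m K) = \tr (S *m S *m K *m K).
  by rewrite -!mulmxA mxtrace_mulC !mulmxA.
have -> : \tr (K *m S *m K *m S) = \tr (S *m K *m S *m K).
  by rewrite -!mulmxA mxtrace_mulC !mulmxA.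
by ring.
Qed.

(** [W] intertwines the conjugated matrix with [A], hence also their square roots; the eigenbasis
    chosen for the conjugated matrix need not be the image of the one chosen for [A]. *)
Lemma msqrt_conj_unitary n (A W : 'M[C]_n) : A \is normalmx ->
  W \is unitarymx -> msqrt (W *m A *m W^t*) = W *m msqrt A *m W^t*.
Proof.
move=> An Wu; have /unitarymxP Wu1 := Wu.
rewrite -[LHS]mulmx1 -Wu1 mulmxA; congr (_ *m _).
apply: msqrt_intertwine => //; first exact: unitary_conj_normal.
by rewrite -mulmxA (mul_adjmx_unitary Wu) mulmx1.
Qed.

Lemma tr_comm_conj_unitary n (S K W : 'M[C]_n) : W \is unitarymx ->
  let c A B := A *m B - B *m A in
  let D := c S (W^t* *m K *m W) in let E := c (W *m S *m W^t*) K in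
  \tr (E *m E) = \tr (D *m D).
Proof.
move=> Wu c D E; have Wu' := mul_adjmx_unitary Wu; have /unitarymxP Wu1 := Wu.
have -> : E = W *m D *m W^t*.
  rewrite /E /D /c mulmxBr mulmxBl !mulmxA Wu1 mul1mx.
  by congr (_ - _); rewrite -[RHS]mulmxA Wu1 mulmx1.
clearbody D; rewrite !mulmxA -(mulmxA _ (W^t*) W) Wu' mulmx1.
by rewrite -(mulmxA W) mxtrace_conj_unitary.
Qed.

End PositiveMatrices.

(** * Local unitaries on a tensor product *)

Section Tensor.
Context {C : numClosedFieldType}.

Lemma tens_adj1 m n (K : 'M[C]_m) :
  K^t* = K -> (K *t (1%:M : 'M[C]_n))^t* = K *t (1%:M : 'M[C]_n).
Proof. by move=> Kh; rewrite adjmx_tens adjmx1 Kh. Qed.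

Lemma tens11 m n : (1%:M : 'M[C]_m) *t (1%:M : 'M[C]_n) = 1%:M.
Proof.
apply/matrixP=> i j; case: (mxtens_indexP i) => i1 i2.
case: (mxtens_indexP j) => j1 j2; rewrite tensmxE !mxE.
by rewrite (can_eq (@mxtens_indexK _ _)) xpair_eqE -natrM mulnb.
Qed.

Lemma unitary_tens m n (U : 'M[C]_m) (V : 'M[C]_n) :
  U \is unitarymx -> V \is unitarymx -> U *t V \is unitarymx.
Proof.
move=> /unitarymxP Uu /unitarymxP Vu; apply/unitarymxP.
by rewrite adjmx_tens tensmx_mul Uu Vu tens11.
Qed.

(** The unitary on the second factor cancels against its adjoint, so a local observable of the first
    factor stays local. *)
Lemma local_unitary_conj m n (U K : 'M[C]_m) (V : 'M[C]_n) : V \is unitarymx ->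
  (U *t V)^t* *m (K *t 1%:M) *m (U *t V) = (U^t* *m K *m U) *t 1%:M.
Proof.
by move=> Vu; rewrite adjmx_tens !tensmx_mul mulmx1 (mul_adjmx_unitary Vu).
Qed.

Lemma unitary_tens_conjK m n (U : 'M[C]_m) (V : 'M[C]_n) (X : 'M[C]_(m * n)) :
  U \is unitarymx -> V \is unitarymx ->
  (U^t* *t V^t*) *m ((U *t V) *m X *m (U *t V)^t*) *m (U^t* *t V^t*)^t* = X.
Proof.
move=> Uu Vu; have Wu := unitary_tens Uu Vu.
rewrite -adjmx_tens trmxCK !mulmxA (mul_adjmx_unitary Wu) mul1mx.
by rewrite -mulmxA (mul_adjmx_unitary Wu) mulmx1.
Qed.

End Tensor.

(** * Skew information and local unitaries *)

Section SkewInformation.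
Context {R : realType}.
Local Notation C := R[i].

Lemma sqrtmx_herm n (A : 'M[C]_n) : psdmx A -> (sqrtmx A)^t* = sqrtmx A.
Proof. exact: msqrt_herm. Qed.

(** The commutator D of two Hermitian matrices is anti-Hermitian, so - D D is D times its adjoint;
    its trace is real, which removes [complex.Re]. *)
Lemma skew_infoE n (rho K : 'M[C]_n) : psdmx rho -> K^t* = K ->
  (skew_info rho K)%:C = 2^-1 * \tr (commutator (sqrtmx rho) K
                                     *m (commutator (sqrtmx rho) K)^t*).
Proof.
move=> rp Kh; rewrite /skew_info.
have : (commutator (sqrtmx rho) K)^t* = - commutator (sqrtmx rho) K.
  exact: comm_adj (sqrtmx_herm rp) Kh.
move: (commutator _ _) => D Ch.
have := mxtrace_mul_adj_ge0 D; rewrite Ch mulmxN linearN /= => t0.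
have tr_real : \tr (D *m D) \is Num.real by rewrite -rpredN ger0_real.
rewrite rmorphN rmorphM /= fmorphV rmorph_nat RRe_real //.
by rewrite mulrN.
Qed.

Lemma skew_info_ge0 n (rho K : 'M[C]_n) : psdmx rho -> K^t* = K ->
  0 <= skew_info rho K.
Proof.
move=> rp Kh; rewrite -ler0c skew_infoE //.
by rewrite mulr_ge0 ?invr_ge0 ?ler0n ?mxtrace_mul_adj_ge0.
Qed.

Lemma skew_info_eq0 n (rho K : 'M[C]_n) : psdmx rho -> K^t* = K ->
  skew_info rho K = 0 <-> rho *m K = K *m rho.
Proof.
move=> rp Kh; have rn := psd_normal rp; rewrite -msqrt_comm //.
split=> [s0|rK]; last first.
  by rewrite /skew_info [commutator _ _]rK mulmx0 linear0 /= mulr0 oppr0.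
have := skew_infoE rp Kh; rewrite s0 => /esym/eqP.
by rewrite mulf_eq0 invr_eq0 pnatr_eq0 /= => /eqP/mxtrace_mul_adj_eq0.
Qed.

Lemma skew_info_expand n (rho K : 'M[C]_n) : psdmx rho -> K^t* = K ->
  (skew_info rho K)%:C = wy_skew rho K.
Proof.
move=> rp Kh; rewrite skew_infoE //.
have -> : (commutator (sqrtmx rho) K)^t* = - commutator (sqrtmx rho) K.
  exact: comm_adj (sqrtmx_herm rp) Kh.
have := tr_comm_sqr (sqrtmx rho) K; rewrite (msqrt_sq (psd_normal rp)).
rewrite mulmxN linearN /= => ->.
by rewrite mulKf // pnatr_eq0.
Qed.

Lemma skew_info_conj n (rho K W : 'M[C]_n) : rho \is normalmx ->
  W \is unitarymx ->
  skew_info (W *m rho *m W^t*) K = skew_info rho (W^t* *m K *m W).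
Proof.
move=> rn Wu.
have SW : sqrtmx (W *m rho *m W^t*) = W *m sqrtmx rho *m W^t*.
  exact: msqrt_conj_unitary.
by rewrite /skew_info SW (tr_comm_conj_unitary (sqrtmx rho) K Wu).
Qed.

Lemma with_spectrum_herm n (L : 'rV[R]_n) K : with_spectrum L K -> K^t* = K.
Proof.
case=> V [_ ->]; rewrite !adjmxM trmxCK adjmx_diag_real ?mulmxA // => i.
by rewrite mxE complex_real.
Qed.

Lemma with_spectrum_conj n (L : 'rV[R]_n) K U : U \is unitarymx ->
  with_spectrum L K -> with_spectrum L (U *m K *m U^t*).
Proof.
move=> Uu [V [Vu ->]]; exists (U *m V); split; first exact: mul_unitarymx.
by rewrite adjmxM !mulmxA.
Qed.

Local Open Scope classical_set_scope.

Definition skew_set dA dB (L : 'rV[R]_dA) (rho : 'M[C]_(dA * dB)) : set R :=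
  [set skew_info rho (K *t (1%:M : 'M[C]_dB)) | K in with_spectrum L].

(** The unitary moves from the state to the observable, and the observables with spectrum [L] are
    stable under unitary conjugation. *)
Lemma skew_set_conj_sub dA dB (L : 'rV[R]_dA) (rho : 'M[C]_(dA * dB))
    (UA : 'M[C]_dA) (UB : 'M[C]_dB) :
  rho \is normalmx -> UA \is unitarymx -> UB \is unitarymx ->
  skew_set L ((UA *t UB) *m rho *m (UA *t UB)^t*) `<=` skew_set L rho.
Proof.
move=> rn Au Bu _ [K KL <-]; exists (UA^t* *m K *m UA).
  have Au' : UA^t* \is unitarymx by rewrite trmxC_unitary.
  by have := with_spectrum_conj Au' KL; rewrite trmxCK.
by rewrite (skew_info_conj _ rn (unitary_tens Au Bu)) local_unitary_conj.
Qed.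

Lemma lqu_local_unitary dA dB (L : 'rV[R]_dA) (rho : 'M[C]_(dA * dB))
    (UA : 'M[C]_dA) (UB : 'M[C]_dB) :
  rho \is normalmx -> UA \is unitarymx -> UB \is unitarymx ->
  lqu L ((UA *t UB) *m rho *m (UA *t UB)^t*) = lqu L rho.
Proof.
move=> rn Au Bu; have Wu := unitary_tens Au Bu.
suff H : skew_set L ((UA *t UB) *m rho *m (UA *t UB)^t*) = skew_set L rho.
  exact: (congr1 (@minimum R) H).
apply/seteqP; split; first exact: skew_set_conj_sub.
(* The reverse inclusion is the first one applied to the rotated state and the inverse unitaries. *)
have Au' : UA^t* \is unitarymx by rewrite trmxC_unitary.
have Bu' : UB^t* \is unitarymx by rewrite trmxC_unitary.
have := skew_set_conj_sub (L := L) (unitary_conj_normal Wu rn) Au' Bu'.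
by rewrite (unitary_tens_conjK _ Au Bu).
Qed.

Lemma minimum_eq (S : set R) x : S x -> lbound S x -> minimum S = x.
Proof.
move=> Sx lx; apply: xget_unique => [|y [Sy ly]]; first by split.
by apply/eqP; rewrite eq_le ly // lx.
Qed.

End SkewInformation.

(** * Monotonicity under Kraus maps *)

Section Kraus.
Context {C : numClosedFieldType} {n : nat} {I : finType}.
Implicit Types (G : I -> 'M[C]_n) (X Y Z S : 'M[C]_n).

Definition kraus G X := \sum_k G k *m X *m (G k)^t*.

Definition kraus_dual G X := \sum_k (G k)^t* *m X *m G k.

Lemma kraus_is_linear G : linear (kraus G).
Proof.
move=> a X Y; rewrite /kraus scaler_sumr -big_split; apply: eq_bigr => k _ /=.
by rewrite mulmxDr mulmxDl -scalemxAr -scalemxAl.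
Qed.
HB.instance Definition _ G := GRing.isLinear.Build C _ _ _ (kraus G) (kraus_is_linear G).

Lemma kraus_dual_is_linear G : linear (kraus_dual G).
Proof.
move=> a X Y; rewrite /kraus_dual scaler_sumr -big_split; apply: eq_bigr => k _ /=.
by rewrite mulmxDr mulmxDl -scalemxAr -scalemxAl.
Qed.
HB.instance Definition _ G :=
  GRing.isLinear.Build C _ _ _ (kraus_dual G) (kraus_dual_is_linear G).

Lemma kraus_dual_adj G X : kraus_dual G (X^t*) = (kraus_dual G X)^t*.
Proof.
by rewrite adjmx_sum; apply: eq_bigr => k _; rewrite !adjmxM trmxCK mulmxA.
Qed.

Lemma mxtrace_kraus G X Y : \tr (kraus G X *m Y) = \tr (X *m kraus_dual G Y).
Proof.
rewrite mulmx_suml mulmx_sumr !raddf_sum; apply: eq_bigr => k _ /=.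
by rewrite -!mulmxA mxtrace_mulC !mulmxA.
Qed.

Lemma kraus_psd G X : psd X -> psd (kraus G X).
Proof.
move=> Xp; split=> [|v].
  apply/hermsymmxP; rewrite adjmx_sum; apply: eq_bigr => k _.
  by rewrite !adjmxM trmxCK (psd_herm Xp) mulmxA.
rewrite mulmx_sumr mulmx_suml summxE; apply: sumr_ge0 => k _.
by have [_ /(_ v)] := psd_congr (G k) Xp.
Qed.

(** The Kadison-Schwarz inequality under a trace: with P the dual image of [Y], the gap is the sum
    over k of T_k^+ T_k, where T_k = Y G_k - G_k P and ^+ is the adjoint. *)
Lemma kraus_schwarz G S Y : \sum_k (G k)^t* *m G k = 1%:M ->
  \tr (S *m ((kraus_dual G Y)^t* *m kraus_dual G Y) *m S^t*) <=
  \tr (S *m kraus_dual G (Y^t* *m Y) *m S^t*).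
Proof.
move=> G1; set P := kraus_dual G Y.
pose T k := Y *m G k - G k *m P.
have TE : \sum_k (T k)^t* *m T k = kraus_dual G (Y^t* *m Y) - P^t* *m P.
  (* The added terms cancel because the sum of the G_k^+ G_k is the identity; in this form the right
     side matches the expansion of T_k^+ T_k term by term in k. *)
  have -> : kraus_dual G (Y^t* *m Y) - P^t* *m P =
    kraus_dual G (Y^t* *m Y) - kraus_dual G (Y^t*) *m P
      - (P^t* *m kraus_dual G Y - P^t* *m (\sum_k (G k)^t* *m G k) *m P).
    by rewrite G1 mulmx1 kraus_dual_adj -/P subrr subr0.
  rewrite /kraus_dual /T; clearbody P.
  rewrite mulmx_suml !mulmx_sumr mulmx_suml -!sumrB.
  by apply: eq_bigr => k _; rewrite adjmxB !adjmxM mulmxBl !mulmxBr !mulmxA.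
rewrite -subr_ge0 -raddfB -mulmxBl -mulmxBr -TE mulmx_sumr mulmx_suml raddf_sum.
apply: sumr_ge0 => k _ /=.
by have := mxtrace_mul_adj_ge0 (S *m (T k)^t*); rewrite adjmxM trmxCK !mulmxA.
Qed.

Lemma mxtrace_diag_mul_adj (d : 'rV[C]_n) X :
  \tr (diag_mx d *m (X *m X^t*)) = \sum_i \sum_j d 0 i * `|X i j| ^+ 2.
Proof.
apply: eq_bigr => i _; rewrite mul_diag_mx !mxE mulr_sumr.
by apply: eq_bigr => j _; rewrite !mxE normCK.
Qed.

Lemma mxtrace_diag_adj_mul (d : 'rV[C]_n) X :
  \tr (diag_mx d *m (X^t* *m X)) = \sum_i \sum_j d 0 j * `|X i j| ^+ 2.
Proof.
have := mxtrace_diag_mul_adj d (X^t*); rewrite trmxCK => ->.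
rewrite exchange_big; apply: eq_bigr => i _; apply: eq_bigr => j _ /=.
by rewrite !mxE norm_conjC.
Qed.

Lemma sum_mxvec (F : 'I_(n * n) -> C) :
  \sum_k F k = \sum_i \sum_j F (mxvec_index i j).
Proof.
rewrite (reindex _ (curry_mxvec_bij _ _)) pair_bigA.
by apply: eq_bigr => -[i j].
Qed.

Lemma le_of_quadratic_perturbation (q p c : C) : 0 <= c ->
  (forall e, 0 < e -> e <= 1 -> q <= p + e * c) -> q <= p.
Proof.
move=> c0 H; have := H _ ltr01 (lexx _); rewrite mul1r => q1.
apply/ler_addgt0Pr => e e0.
have ec : 0 < e + c + 1 by rewrite ltr_wpDl // addr_ge0 // ltW.
(* This parameter lies in (0, 1], and its product with [c] is at most [e]. *)
have := H (e / (e + c + 1)); rewrite divr_gt0 // ler_pdivrMr // mul1r.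
rewrite -addrA lerDl addr_ge0 // => /(_ isT isT)/le_trans; apply.
rewrite lerD2l addrA mulrAC ler_pdivrMr // ler_pM2l //.
by rewrite -addrA addrCA lerDl addr_ge0 // ltW.
Qed.

(** The case of a diagonal channel output, where [S] is a Hermitian square root of the input and [r]
    lists the eigenvalues of the root of the output. The matrix units are then common eigenvectors
    of left and right multiplication by the output, so the geometric mean bound applies to
    coordinates of [mxvec X]. *)
Lemma kraus_sqrt_mono_diag G S (r : 'rV[C]_n) X :
  \sum_k (G k)^t* *m G k = 1%:M -> S^t* = S -> (forall i, 0 <= r 0 i) ->
  kraus G (S *m S) = diag_mx (\row_i r 0 i ^+ 2) ->
  \tr (S *m kraus_dual G X *m S *m (kraus_dual G X)^t*) <=
  \sum_i \sum_j r 0 i * r 0 j * `|X i j| ^+ 2.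
Proof.
move=> G1 Sh r0 Gr.
(* This operator represents the form Q with respect to the Hilbert-Schmidt product; moving the outer
   channel to its dual gives the formula [QE]. *)
pose f Z := kraus G (S *m kraus_dual G Z *m S).
have f_lin : linear f.
  by move=> a Y Z; rewrite /f linearP mulmxDr mulmxDl -scalemxAr -scalemxAl linearP.
pose F := GRing.isLinear.Build C _ _ _ f f_lin.
pose fL : {linear 'M[C]_n -> 'M[C]_n} := HB.pack f F.
pose Q := lin_mx fL.
have QE Y Z : (mxvec Y *m Q *m (mxvec Z)^t*) 0 0 =
    \tr (S *m kraus_dual G Y *m S *m (kraus_dual G Z)^t*).
  rewrite mul_vec_lin -dotmxE dotmx_mxvec /= /f mxtrace_kraus.
  by rewrite kraus_dual_adj.
clearbody Q.
have Qherm : Q \is hermsymmx.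
  have QC (x y : 'rV_(n * n)) : (x *m Q *m y^t*) 0 0 = Num.conj ((y *m Q *m x^t*) 0 0).
    rewrite -[x]vec_mxK -[y]vec_mxK !QE -mxtrace_adj !adjmxM trmxCK Sh !mulmxA.
    by rewrite [RHS]mxtrace_mulC !mulmxA.
  pose u i : 'rV[C]_(n * n) := delta_mx 0 i.
  have QdE i j : (u i *m Q *m (u j)^t*) 0 0 = Q i j.
    by rewrite trmx_delta map_delta_mx -colE -rowE !mxE.
  by apply/hermsymmxP/matrixP=> i j; rewrite !mxE -[RHS]QdE QC QdE.
have xxE Z (w : 'I_(n * n) -> C) : \sum_k w k * `|(mxvec Z) 0 k| ^+ 2 =
    \sum_i \sum_j w (mxvec_index i j) * `|Z i j| ^+ 2.
  by rewrite sum_mxvec; do 2 ![apply: eq_bigr => ? _]; rewrite mxvecE.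
(* Since e <= 1, the product (r_i + e)(r_j + e) exceeds r_i r_j by e (r_i + r_j + e) <= e (r_i + r_j
   + 1), whence the constant. *)
apply: (@le_of_quadratic_perturbation _ _
  (\sum_i \sum_j (r 0 i + r 0 j + 1) * `|X i j| ^+ 2)).
  do 2 ![apply: sumr_ge0 => ? _].
  by rewrite mulr_ge0 ?exprn_ge0 // !addr_ge0.
move=> e e0 e1.
(* On the matrix unit E_ij, left and right multiplication by the perturbed root of the output have
   eigenvalues r_i + e and r_j + e, both positive. *)
pose a k := mxvec (\matrix_(i < n, j < n) (r 0 i + e)) 0 k.
pose b k := mxvec (\matrix_(i < n, j < n) (r 0 j + e)) 0 k.
have aE i j : a (mxvec_index i j) = r 0 i + e by rewrite /a mxvecE mxE.
have bE i j : b (mxvec_index i j) = r 0 j + e by rewrite /b mxvecE mxE.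
have re i : 0 < r 0 i + e by rewrite ltr_wpDl.
have a0 k : 0 < a k by case/mxvec_indexP: k => i j; rewrite aE.
have b0 k : 0 < b k by case/mxvec_indexP: k => i j; rewrite bE.
have r2 i : r 0 i ^+ 2 <= (r 0 i + e) ^+ 2.
  by rewrite lerXn2r ?nnegrE ?r0 ?(ltW (re _)) // lerDl ltW.
have SS Y : \tr (S *m kraus_dual G Y *m S^t*) =
    \tr (diag_mx (\row_i r 0 i ^+ 2) *m Y).
  by rewrite -Gr mxtrace_kraus Sh -[LHS]mxtrace_mulC !mulmxA.
have Qab (x y : 'rV_(n * n)) : `|(x *m Q *m y^t*) 0 0| ^+ 2 <=
    (\sum_k a k ^+ 2 * `|x 0 k| ^+ 2) * (\sum_k b k ^+ 2 * `|y 0 k| ^+ 2).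
  rewrite -[x]vec_mxK -[y]vec_mxK; move: (vec_mx x) (vec_mx y) => {x y} Y Z.
  rewrite QE; set P := kraus_dual G Y; set V := kraus_dual G Z.
  (* Cauchy-Schwarz separates S P from V S. Kadison-Schwarz for the adjoint of [Y] bounds the first
     factor by row weights, and for [Z] it bounds the second by column weights. *)
  have -> : S *m P *m S *m V^t* = (S *m P) *m (V *m S)^t*.
    by rewrite adjmxM Sh !mulmxA.
  apply: (le_trans (mxtrace_mul_adj_CS _ _)).
  apply: ler_pM; rewrite ?mxtrace_mul_adj_ge0 // xxE.
    have := kraus_schwarz S (Y^t*) G1; rewrite kraus_dual_adj !trmxCK -/P SS.
    rewrite mxtrace_diag_mul_adj adjmxM !mulmxA => /le_trans; apply.
    by do 2 ![apply: ler_sum => ? _]; rewrite aE ler_wpM2r ?exprn_ge0 // mxE.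
  have := kraus_schwarz S Z G1; rewrite -/V SS mxtrace_diag_adj_mul => H.
  apply: (@le_trans _ _ (\tr (S *m (V^t* *m V) *m S^t*))).
    by rewrite adjmxM Sh mxtrace_mulC !mulmxA.
  apply: (le_trans H).
  by do 2 ![apply: ler_sum => ? _]; rewrite bE ler_wpM2r ?exprn_ge0 // mxE.
have := form_le_geometric_mean Qherm a0 b0 Qab (mxvec X).
rewrite QE (xxE X (fun k => a k * b k)) => /le_trans; apply.
rewrite mulr_sumr -big_split; apply: ler_sum => i _ /=.
rewrite mulr_sumr -big_split; apply: ler_sum => j _ /=.
rewrite aE bE [e * _]mulrA -mulrDl ler_wpM2r ?exprn_ge0 //.
have -> : (r 0 i + e) * (r 0 j + e) =
  r 0 i * r 0 j + e * (r 0 i + r 0 j + e) by ring.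
by rewrite lerD2l ler_pM2l // lerD2l.
Qed.

(** Reduces to a diagonal output by following the channel with conjugation by the unitary [U] that
    diagonalises [kraus G A], and replacing [X] by its conjugate. *)
Lemma kraus_msqrt_mono G (A : 'M[C]_n) X :
  \sum_k (G k)^t* *m G k = 1%:M -> psd A ->
  \tr (msqrt A *m kraus_dual G X *m msqrt A *m (kraus_dual G X)^t*) <=
  \tr (msqrt (kraus G A) *m X *m msqrt (kraus G A) *m X^t*).
Proof.
move=> G1 Ap; have Bp := kraus_psd G Ap; set B := kraus G A in Bp *.
have Be := normal_spectralE (psd_normal Bp).
have Uu := spectral_unitarymx B; set U := spectralmx B in Be Uu.
have Uu' := mul_adjmx_unitary Uu; have /unitarymxP Uu1 := Uu.
pose H k := U *m G k; pose r := map_mx sqrtC (spectral_diag B).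
have r0 i : 0 <= r 0 i by rewrite mxE sqrtC_ge0 psd_spectral_diag_ge0.
have H1 : \sum_k (H k)^t* *m H k = 1%:M.
  rewrite -G1; apply: eq_bigr => k _.
  by rewrite /H adjmxM mulmxA -(mulmxA _ (U^t*) U) Uu' mulmx1.
have HB : kraus H (msqrt A *m msqrt A) = diag_mx (\row_i r 0 i ^+ 2).
  rewrite msqrt_sq ?psd_normal //.
  transitivity (U *m B *m U^t*).
    rewrite /B /kraus mulmx_sumr mulmx_suml; apply: eq_bigr => k _.
    by rewrite /H adjmxM !mulmxA.
  rewrite Be !mulmxA Uu1 mul1mx -mulmxA Uu1 mulmx1; congr diag_mx.
  by apply/rowP=> i; rewrite !mxE sqrtCK.
have Hdual : kraus_dual H (U *m X *m U^t*) = kraus_dual G X.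
  apply: eq_bigr => k _; rewrite /H adjmxM !mulmxA -(mulmxA _ (U^t*) U) Uu' mulmx1.
  by rewrite -(mulmxA _ (U^t*) U) Uu' mulmx1.
have := kraus_sqrt_mono_diag (U *m X *m U^t*) H1 (msqrt_herm Ap) r0 HB.
rewrite Hdual => /le_trans; apply; rewrite le_eqVlt; apply/orP; left; apply/eqP.
rewrite /msqrt -/U -/r.
transitivity (\tr (diag_mx r *m (U *m X *m U^t*) *m diag_mx r
                   *m (U *m X *m U^t*)^t*)).
  apply: eq_bigr => i _; rewrite [RHS]mxE; apply: eq_bigr => j _.
  rewrite mul_mx_diag mul_diag_mx; move: (U *m X *m U^t*) => Y; rewrite !mxE normCK.
  by ring.
rewrite !adjmxM trmxCK !mulmxA mxtrace_mulC !mulmxA.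
by [].
Qed.

End Kraus.

(** * Operations on the second factor *)

Section LocalKraus.
Context {C : numClosedFieldType}.

Definition choi n (Phi : 'M[C]_n -> 'M[C]_n) : 'M[C]_(n * n) :=
  \matrix_(p, q) Phi (delta_mx (mxtens_unindex p).1 (mxtens_unindex q).1)
                   (mxtens_unindex p).2 (mxtens_unindex q).2.

Lemma choiE n (Phi : 'M[C]_n -> 'M[C]_n) i j a b :
  choi Phi (mxtens_index (i, a)) (mxtens_index (j, b)) = Phi (delta_mx i j) a b.
Proof. by rewrite mxE !mxtens_indexK. Qed.

Lemma linear_delta_eq n (Phi Psi : {linear 'M[C]_n -> 'M[C]_n}) :
  (forall i j, Phi (delta_mx i j) = Psi (delta_mx i j)) -> Phi =1 Psi.
Proof.
move=> H X; rewrite [X]matrix_sum_delta !linear_sum; apply: eq_bigr => i _.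
by rewrite !linear_sum; apply: eq_bigr => j _; rewrite !linearZ H.
Qed.

(* The Kraus operators are the reshaped columns of a square root of the Choi
   matrix. *)
Lemma choi_psd_kraus n (Phi : {linear 'M[C]_n -> 'M[C]_n}) :
  psd (choi Phi) -> exists F : 'I_(n * n) -> 'M[C]_n, Phi =1 kraus F.
Proof.
move=> Cp; have Sq := msqrt_sq (psd_normal Cp); have Sh := msqrt_herm Cp.
rewrite -{2}Sh in Sq; move: (msqrt _) Sq {Sh} => S Sq.
pose F k := \matrix_(a < n, i < n) S (mxtens_index (i, a)) k.
exists F; apply: linear_delta_eq => i j; apply/matrixP=> a b.
rewrite -choiE -Sq mxE summxE; apply: eq_bigr => k _.
(* A matrix unit factors through dimension one, so each summand is column [i] of [F k] times the
   adjoint of column [j], that is, a product of two entries of [S] and its adjoint. *)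
rewrite -(mul_delta_mx (0 : 'I_1)) mulmxA -colE -mulmxA -rowE.
by rewrite [RHS]mxE big_ord1 !mxE.
Qed.

(** The difference [D - 1%:M] is orthogonal to every matrix under the trace pairing; testing it
    against its own adjoint shows that it vanishes. *)
Lemma kraus_trace_preserving n (I : finType) (F : I -> 'M[C]_n) :
  (forall X, \tr (kraus F X) = \tr X) -> \sum_k (F k)^t* *m F k = 1%:M.
Proof.
move=> trF; set D := \sum_k _.
have DE : kraus_dual F 1%:M = D by apply: eq_bigr => k _; rewrite mulmx1.
have tr0 X : \tr (X *m (D - 1%:M)) = 0.
  by rewrite mulmxBr raddfB /= -DE -mxtrace_kraus !mulmx1 trF subrr.
have := tr0 ((D - 1%:M)^t*); rewrite -{2}[D - 1%:M]trmxCK.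
move=> /mxtrace_mul_adj_eq0 /(congr1 (fun X => X^t*)).
by rewrite trmxCK trmx0 map_mx0 => /eqP; rewrite subr_eq0 => /eqP.
Qed.

Lemma tensmx_sumr m n p q (I : finType) (A : 'M[C]_(m, n))
    (B : I -> 'M[C]_(p, q)) : A *t (\sum_k B k) = \sum_k A *t B k.
Proof.
apply/matrixP=> i j; rewrite !mxE !summxE mulr_sumr.
by apply: eq_bigr => k _; rewrite !mxE.
Qed.

Definition local_op m n (I : finType) (F : I -> 'M[C]_n) k : 'M[C]_(m * n) :=
  1%:M *t F k.

Lemma local_op_isometry m n (I : finType) (F : I -> 'M[C]_n) :
  \sum_k (F k)^t* *m F k = 1%:M ->
  \sum_k (local_op m F k)^t* *m local_op m F k = 1%:M.
Proof.
move=> F1; rewrite -tens11 -F1 tensmx_sumr; apply: eq_bigr => k _.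
by rewrite /local_op adjmx_tens adjmx1 tensmx_mul mul1mx.
Qed.

(** The dual channel is unital on the second factor, so observables of the first factor are fixed
    points; the Lieb-type inequality is applied to such an [X]. *)
Lemma kraus_dual_local m n (I : finType) (F : I -> 'M[C]_n) (K : 'M[C]_m) :
  \sum_k (F k)^t* *m F k = 1%:M ->
  kraus_dual (local_op m F) (K *t 1%:M) = K *t 1%:M.
Proof.
move=> F1; rewrite -[in RHS]F1 tensmx_sumr; apply: eq_bigr => k _.
by rewrite /local_op adjmx_tens adjmx1 !tensmx_mul mul1mx !mulmx1.
Qed.

Lemma sum_mxtens m n (f : 'I_(m * n) -> C) :
  \sum_p f p = \sum_i \sum_c f (mxtens_index (i, c)).
Proof.
rewrite pair_bigA (reindex (@mxtens_index m n)) /=; first by apply: eq_bigr => -[].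
exists (@mxtens_unindex m n) => ? _; [exact: mxtens_indexK|exact: mxtens_unindexK].
Qed.

(** Agrees with [blockmx] over [R[i]], up to the order of the arguments. *)
Definition block m n (X : 'M[C]_(m * n)) i j : 'M[C]_n :=
  \matrix_(a, b) X (mxtens_index (i, a)) (mxtens_index (j, b)).

Lemma block_mul_l m n (X : 'M[C]_(m * n)) (B : 'M[C]_n) i j :
  block ((1%:M *t B) *m X) i j = B *m block X i j.
Proof.
apply/matrixP=> a b; rewrite !mxE sum_mxtens (bigD1 i) //=.
rewrite [X in _ + X]big1 ?addr0 => [|k /negPf ki].
  by apply: eq_bigr => c _; rewrite tensmxE !mxE eqxx mul1r.
by apply: big1 => c _; rewrite tensmxE mxE eq_sym ki !mul0r.
Qed.

Lemma block_mul_r m n (X : 'M[C]_(m * n)) (B : 'M[C]_n) i j :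
  block (X *m (1%:M *t B)) i j = block X i j *m B.
Proof.
apply/matrixP=> a b; rewrite !mxE sum_mxtens (bigD1 j) //=.
rewrite [X in _ + X]big1 ?addr0 => [|k /negPf kj].
  by apply: eq_bigr => c _; rewrite tensmxE !mxE eqxx mul1r.
by apply: big1 => c _; rewrite tensmxE mxE kj !mul0r mulr0.
Qed.

Lemma block_kraus_local m n (I : finType) (F : I -> 'M[C]_n) (X : 'M[C]_(m * n)) i j :
  block (kraus (local_op m F) X) i j = kraus F (block X i j).
Proof.
transitivity (\sum_k block (local_op m F k *m X *m (local_op m F k)^t*) i j).
  apply/matrixP=> a b; rewrite mxE /kraus !summxE.
  by apply: eq_bigr => k _; rewrite [RHS]mxE.
apply: eq_bigr => k _.
by rewrite /local_op adjmx_tens adjmx1 block_mul_r block_mul_l.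
Qed.

(** The linear term is unchanged, since the dual channel fixes the square of [K *t 1%:M]; the other
    term can only grow and enters with a minus sign. *)
Lemma local_kraus_skew_mono m n (I : finType) (F : I -> 'M[C]_n)
    (A : 'M[C]_(m * n)) (K : 'M[C]_m) :
  \sum_k (F k)^t* *m F k = 1%:M -> psd A -> K^t* = K ->
  wy_skew (kraus (local_op m F) A) (K *t 1%:M) <= wy_skew A (K *t 1%:M).
Proof.
move=> F1 Ap Kh; rewrite /wy_skew mxtrace_kraus.
have -> : (K *t 1%:M) *m (K *t 1%:M) = (K *m K) *t (1%:M : 'M[C]_n).
  by rewrite tensmx_mul mulmx1.
rewrite kraus_dual_local // lerD2l lerN2.
have := kraus_msqrt_mono (K *t 1%:M) (local_op_isometry m F1) Ap.
by rewrite kraus_dual_local // tens_adj1.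
Qed.

Lemma block_inj m n (X Y : 'M[C]_(m * n)) :
  (forall i j, block X i j = block Y i j) -> X = Y.
Proof.
move=> XY; apply/matrixP=> p q; case: (mxtens_indexP p) => i a.
case: (mxtens_indexP q) => j b; have /matrixP/(_ a b) := XY i j.
by rewrite !mxE.
Qed.

End LocalKraus.

(** * Completely positive maps on the second factor *)

Section LocalOperations.
Context {R : realType}.
Local Notation C := R[i].

Lemma block_id_tens m n (Phi : {linear 'M[C]_n -> 'M[C]_n}) (X : 'M[C]_(m * n)) i j :
  block (id_tens Phi X) i j = Phi (block X i j).
Proof.
apply/matrixP=> a b; rewrite mxE summxE (bigD1 i) //= summxE (bigD1 j) //=.
rewrite tensmxE mxE !eqxx mul1r !big1 ?addr0 // => [k /negPf ki|k /negPf kj].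
  by rewrite summxE big1 // => l _; rewrite tensmxE mxE eq_sym ki mul0r.
by rewrite tensmxE mxE eqxx eq_sym kj mul0r.
Qed.

Lemma completely_positive_kraus n (Phi : {linear 'M[C]_n -> 'M[C]_n}) :
  completely_positive Phi -> exists F : 'I_(n * n) -> 'M[C]_n, Phi =1 kraus F.
Proof.
move=> cpP; apply: choi_psd_kraus.
(* The unnormalised maximally entangled vector: block (i, j) of its projector is the matrix unit
   E_ij, so [id_tens Phi] sends the projector to the Choi matrix. *)
pose w : 'cV[C]_(n * n) :=
  \col_p ((mxtens_unindex p).1 == (mxtens_unindex p).2)%:R.
have : psd (id_tens Phi (w *m w^t*)) by apply: cpP; apply: psd_mul_adj.
suff -> : id_tens Phi (w *m w^t*) = choi Phi by [].
apply: block_inj => i j; rewrite block_id_tens.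
have -> : block (w *m w^t*) i j = delta_mx i j.
  apply/matrixP=> a b; rewrite !mxE big_ord1 !mxE !mxtens_indexK /=.
  by rewrite conjC_nat -natrM mulnb (eq_sym i) (eq_sym j).
by apply/matrixP=> a b; rewrite [RHS]mxE choiE.
Qed.

Lemma le_real_complex (x y : R) (u v : C) :
  x%:C = u -> y%:C = v -> u <= v -> x <= y.
Proof. by move=> <- <-; rewrite lecR. Qed.

Lemma skew_info_local_mono dA dB (K : 'M[C]_dA) (rho : 'M[C]_(dA * dB))
    (Phi : {linear 'M[C]_dB -> 'M[C]_dB}) :
  psdmx rho -> K^t* = K -> completely_positive Phi -> trace_preserving Phi ->
  skew_info (id_tens Phi rho) (K *t (1%:M : 'M[C]_dB)) <=
  skew_info rho (K *t (1%:M : 'M[C]_dB)).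
Proof.
move=> rp Kh cpP trP; have [F PF] := completely_positive_kraus cpP.
have F1 : \sum_k (F k)^t* *m F k = 1%:M.
  by apply: kraus_trace_preserving => X; rewrite -PF trP.
have idE : id_tens Phi rho = kraus (local_op dA F) rho.
  by apply: block_inj => i j; rewrite block_id_tens block_kraus_local PF.
have sp : psdmx (id_tens Phi rho) by apply: cpP.
have Kh1 := tens_adj1 dB Kh.
have E1 := skew_info_expand rp Kh1; have E2 := skew_info_expand sp Kh1.
have H : wy_skew (id_tens Phi rho) (K *t (1%:M : 'M[C]_dB)) <=
         wy_skew rho (K *t (1%:M : 'M[C]_dB)).
  by rewrite idE; exact: (local_kraus_skew_mono F1 rp Kh).
exact: (le_real_complex E2 E1 H).
Qed.

End LocalOperations.

(** * Attainment of the minimum *)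

Section Attainment.
Context {R : realType}.
Local Notation C := R[i].
Local Open Scope classical_set_scope.

(** Continuity is split into real and imaginary parts so that all topology takes place over [R]. *)
Definition ccontinuous (T : topologicalType) (f : T -> C) : Prop :=
  continuous (fun t => complex.Re (f t)) /\ continuous (fun t => complex.Im (f t)).

Definition mxcontinuous (T : topologicalType) m n (F : T -> 'M[C]_(m, n)) : Prop :=
  forall i j, ccontinuous (fun t => F t i j).

Section Closure.
Variable T : topologicalType.

Lemma ccontinuous_cst (c : C) : ccontinuous (fun _ : T => c).
Proof. by split=> t; apply: cvg_cst. Qed.

Lemma ccontinuousD (f g : T -> C) :
  ccontinuous f -> ccontinuous g -> ccontinuous (fun t => f t + g t).
Proof.
move=> [fr fi] [gr gi]; split=> t.
  rewrite [X in continuous_at t X](_ : _ = fun t => complex.Re (f t) + complex.Re (g t)).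
    by apply: cvgD; [exact: fr|exact: gr].
  by apply/funext => s; case: (f s) (g s) => ? ? [].
rewrite [X in continuous_at t X](_ : _ = fun t => complex.Im (f t) + complex.Im (g t)).
  by apply: cvgD; [exact: fi|exact: gi].
by apply/funext => s; case: (f s) (g s) => ? ? [].
Qed.

Lemma ccontinuousN (f : T -> C) : ccontinuous f -> ccontinuous (fun t => - f t).
Proof.
move=> [fr fi]; split=> t.
  rewrite [X in continuous_at t X](_ : _ = fun t => - complex.Re (f t)).
    by apply: cvgN; exact: fr.
  by apply/funext => s; case: (f s).
rewrite [X in continuous_at t X](_ : _ = fun t => - complex.Im (f t)).
  by apply: cvgN; exact: fi.
by apply/funext => s; case: (f s).
Qed.

Lemma ccontinuousM (f g : T -> C) :
  ccontinuous f -> ccontinuous g -> ccontinuous (fun t => f t * g t).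
Proof.
move=> [fr fi] [gr gi]; split=> t.
  rewrite [X in continuous_at t X](_ : _ = fun t =>
    complex.Re (f t) * complex.Re (g t) - complex.Im (f t) * complex.Im (g t)).
    by apply: cvgB; apply: cvgM;
      [exact: fr|exact: gr|exact: fi|exact: gi].
  by apply/funext => s; case: (f s) (g s) => ? ? [].
rewrite [X in continuous_at t X](_ : _ = fun t =>
  complex.Re (f t) * complex.Im (g t) + complex.Im (f t) * complex.Re (g t)).
  by apply: cvgD; apply: cvgM;
    [exact: fr|exact: gi|exact: fi|exact: gr].
by apply/funext => s; case: (f s) (g s) => ? ? [].
Qed.

Lemma ccontinuous_conj (f : T -> C) :
  ccontinuous f -> ccontinuous (fun t => Num.conj (f t)).
Proof.
move=> [fr fi]; split=> t.
  rewrite [X in continuous_at t X](_ : _ = fun t => complex.Re (f t)); first exact: fr.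
  by apply/funext => s; case: (f s).
rewrite [X in continuous_at t X](_ : _ = fun t => - complex.Im (f t)).
  by apply: cvgN; exact: fi.
by apply/funext => s; case: (f s).
Qed.

Lemma ccontinuous_sum (I : Type) (r : seq I) (F : I -> T -> C) :
  (forall i, ccontinuous (F i)) -> ccontinuous (fun t => \sum_(i <- r) F i t).
Proof.
move=> Fc; elim: r => [|i r IH].
  under [X in ccontinuous X]eq_fun do rewrite big_nil.
  exact: ccontinuous_cst.
under [X in ccontinuous X]eq_fun do rewrite big_cons.
exact: ccontinuousD.
Qed.

Lemma mxcontinuous_cst m n (A : 'M[C]_(m, n)) : mxcontinuous (fun _ : T => A).
Proof. by move=> i j; apply: ccontinuous_cst. Qed.

Lemma mxcontinuousB m n (F G : T -> 'M[C]_(m, n)) :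
  mxcontinuous F -> mxcontinuous G -> mxcontinuous (fun t => F t - G t).
Proof.
move=> Fc Gc i j; under [X in ccontinuous X]eq_fun do rewrite !mxE.
by apply: ccontinuousD => //; apply: ccontinuousN.
Qed.

Lemma mxcontinuousM m n p (F : T -> 'M[C]_(m, n)) (G : T -> 'M[C]_(n, p)) :
  mxcontinuous F -> mxcontinuous G -> mxcontinuous (fun t => F t *m G t).
Proof.
move=> Fc Gc i j; under [X in ccontinuous X]eq_fun do rewrite mxE.
by apply: ccontinuous_sum => k; apply: ccontinuousM.
Qed.

Lemma mxcontinuous_adj m n (F : T -> 'M[C]_(m, n)) :
  mxcontinuous F -> mxcontinuous (fun t => (F t)^t*).
Proof.
move=> Fc i j; under [X in ccontinuous X]eq_fun do rewrite !mxE.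
exact: ccontinuous_conj.
Qed.

Lemma mxcontinuous_tens1 m n (F : T -> 'M[C]_m) :
  mxcontinuous F -> mxcontinuous (fun t => F t *t (1%:M : 'M[C]_n)).
Proof.
move=> Fc i j; under [X in ccontinuous X]eq_fun do rewrite mxE.
by apply: ccontinuousM => //; exact: ccontinuous_cst.
Qed.

Lemma ccontinuous_tr n (F : T -> 'M[C]_n) :
  mxcontinuous F -> ccontinuous (fun t => \tr (F t)).
Proof. by move=> Fc; apply: ccontinuous_sum. Qed.

Lemma continuous_skew_info n (rho : 'M[C]_n) (F : T -> 'M[C]_n) :
  mxcontinuous F -> continuous (fun t => skew_info rho (F t)).
Proof.
move=> Fc t; apply: cvgN; apply: cvgM; first exact: cvg_cst.
have Dc : mxcontinuous (fun t => commutator (sqrtmx rho) (F t)).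
  by apply: mxcontinuousB; apply: mxcontinuousM => //; exact: mxcontinuous_cst.
by have [+ _] := ccontinuous_tr (mxcontinuousM Dc Dc); apply.
Qed.

End Closure.

(** Parametrises complex matrices by real row vectors, where compactness can be obtained from a box
    of segments. *)
Definition mx_of_parts n (v : 'rV[R]_(n * n + n * n)) : 'M[C]_n :=
  \matrix_(i, j) Complex (v 0 (lshift _ (mxvec_index i j)))
                         (v 0 (rshift _ (mxvec_index i j))).

Lemma mx_of_parts_surj n (V : 'M[C]_n) : exists v, mx_of_parts v = V.
Proof.
exists (row_mx (mxvec (map_mx (@complex.Re R) V)) (mxvec (map_mx (@complex.Im R) V))).
by apply/matrixP=> i j; rewrite mxE row_mxEl row_mxEr !mxvecE !mxE; case: (V i j).
Qed.

Lemma mxcontinuous_of_parts n : mxcontinuous (@mx_of_parts n).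
Proof.
move=> i j; split.
  under [X in continuous X]eq_fun do rewrite mxE /=.
  exact: coord_continuous.
under [X in continuous X]eq_fun do rewrite mxE /=.
exact: coord_continuous.
Qed.

Lemma unitarymx_entry_le1 n (V : 'M[C]_n) i j :
  V \is unitarymx -> `|V i j| ^+ 2 <= 1.
Proof.
move=> /unitarymxP Vu; have <- : (V *m V^t*) i i = 1 by rewrite Vu mxE eqxx.
rewrite mxE (bigD1 j) //= !mxE -normCK lerDl sumr_ge0 // => k _.
by rewrite !mxE -normCK exprn_ge0.
Qed.

(** A closed subset of a compact box: the rows of a unitary matrix have norm one, so all real and
    imaginary parts lie in [-1, 1]. *)
Lemma compact_unitary_parts n :
  compact [set v | mx_of_parts v \is @unitarymx C n n].
Proof.
pose box : set 'rV[R]_(n * n + n * n) :=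
  [set v | forall i, `[(- 1 : R), 1]%classic (v ord0 i)].
apply: (@subclosed_compact _ _ box).
- pose D v := mx_of_parts v *m (@mx_of_parts n v)^t* - 1%:M.
  have Dc : mxcontinuous D.
    apply: mxcontinuousB; last exact: mxcontinuous_cst.
    apply: mxcontinuousM; first exact: mxcontinuous_of_parts.
    by apply: mxcontinuous_adj; exact: mxcontinuous_of_parts.
  have [fc _] := ccontinuous_tr (mxcontinuousM Dc (mxcontinuous_adj Dc)).
  (* Unitarity is one real equation: the squared Hilbert-Schmidt norm of [D v] is real, so it
     vanishes exactly when its real part does. *)
  rewrite (_ : mkset _ = (fun v => complex.Re (\tr (D v *m (D v)^t*))) @^-1`
                         [set x | x = 0]).
    by apply: preimage_closed; [move=> v _; exact: fc|exact: closed_eq].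
  apply/seteqP; split=> v /= => [/unitarymxP Vu|D0].
    by rewrite /D Vu subrr mul0mx linear0.
  apply/unitarymxP/eqP; rewrite -subr_eq0 -/(D v); apply/eqP.
  apply: mxtrace_mul_adj_eq0.
  have /ger0_real/RRe_real := mxtrace_mul_adj_ge0 (D v); rewrite D0 => <-.
  by rewrite rmorph0.
- apply: (@rV_compact _ _ (fun=> `[(- 1 : R), 1]%classic)) => _.
  exact: segment_compact.
- move=> v /= Vu k.
  have sq1 (x y : R) : x ^+ 2 + y ^+ 2 <= 1 -> - 1 <= x <= 1.
    move=> xy; rewrite -ler_norml -(expr_le1 (n := 2)) // real_normK ?num_real //.
    by rewrite (le_trans _ xy) // lerDl sqr_ge0.
  have Ve i j : (v 0 (lshift _ (mxvec_index i j))) ^+ 2 +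
      (v 0 (rshift _ (mxvec_index i j))) ^+ 2 <= 1.
    have := unitarymx_entry_le1 i j Vu.
    by rewrite -add_Re2_Im2 mxE /= -[1]/(1%:C) lecR.
  rewrite /= in_itv /=; case: (split_ordP k) => l ->; case/mxvec_indexP: l => i j.
    exact: sq1 (Ve i j).
  by apply: (sq1 _ (v 0 (lshift _ (mxvec_index i j)))); rewrite addrC Ve.
Qed.

Lemma skew_info_min_attained dA dB (L : 'rV[R]_dA) (rho : 'M[C]_(dA * dB)) :
  exists2 K, with_spectrum L K & forall K', with_spectrum L K' ->
    skew_info rho (K *t (1%:M : 'M[C]_dB)) <= skew_info rho (K' *t (1%:M : 'M[C]_dB)).
Proof.
pose U : set 'rV[R]_(dA * dA + dA * dA) := [set v | mx_of_parts v \is unitarymx].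
pose Lam := diag_mx (map_mx (real_complex R) L).
pose Kof v := @mx_of_parts dA v *m Lam *m (mx_of_parts v)^t*.
pose g v := skew_info rho (Kof v *t (1%:M : 'M[C]_dB)).
have gc : continuous g.
  apply: continuous_skew_info; apply: mxcontinuous_tens1.
  apply: mxcontinuousM; last first.
    by apply: mxcontinuous_adj; exact: mxcontinuous_of_parts.
  by apply: mxcontinuousM; [exact: mxcontinuous_of_parts|exact: mxcontinuous_cst].
have U0 : U !=set0.
  have [v v1] := mx_of_parts_surj (1%:M : 'M[C]_dA); exists v.
  by rewrite /U /= v1; apply/unitarymxP; rewrite adjmx1 mulmx1.
have [v] := compact_EVT_min U0 (@compact_unitary_parts dA) (continuous_subspaceT gc).
rewrite inE => Uv vmin; exists (Kof v); first by exists (mx_of_parts v).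
move=> _ [W [Wu ->]]; have [w wW] := mx_of_parts_surj W.
have := vmin w; rewrite inE /U /= wW => /(_ Wu).
by rewrite /g /Kof wW.
Qed.

End Attainment.

(** * Faithfulness *)

Section CommutingWithLocalObservable.
Context {C : numClosedFieldType}.

Lemma psdZ n (c : C) (A : 'M[C]_n) : 0 <= c -> psd A -> psd (c *: A).
Proof.
move=> c0 [/hermsymmxP Ah A0]; split.
  by apply/hermsymmxP; rewrite linearZ map_mxZ /= Ah geC0_conj.
by move=> v; rewrite -scalemxAr -scalemxAl mxE mulr_ge0.
Qed.

(** Selecting rows and columns by the same [f] is congruence by the selected rows of the
    identity. *)
Lemma psd_mxsub m n (f : 'I_m -> 'I_n) (A : 'M[C]_n) : psd A -> psd (mxsub f f A).
Proof.
have -> : mxsub f f A = rowsub f 1%:M *m A *m (rowsub f 1%:M)^t*.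
  have -> : (rowsub f 1%:M)^t* = colsub f 1%:M :> 'M[C]_(n, m).
    by apply/matrixP=> i j; rewrite !mxE eq_sym conjC_nat.
  by rewrite mul_rowsub_mx mul1mx mulmx_colsub mulmx1; apply/matrixP=> i j; rewrite !mxE.
exact: psd_congr.
Qed.

Lemma psd_block m n (A : 'M[C]_(m * n)) i : psd A -> psd (block A i i).
Proof. exact: psd_mxsub. Qed.

Lemma mxtrace_block m n (A : 'M[C]_(m * n)) : \tr A = \sum_i \tr (block A i i).
Proof.
rewrite /mxtrace sum_mxtens; apply: eq_bigr => i _; apply: eq_bigr => a _.
by rewrite mxE.
Qed.

(** Comparing entries in the commutation relation gives (d_i - d_j) X_(ia)(jb) = 0, so distinct
    eigenvalues kill every off-diagonal block. *)
Lemma block_diag_of_comm m n (X : 'M[C]_(m * n)) (d : 'rV[C]_m) :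
  injective (fun i => d 0 i) ->
  X *m (diag_mx d *t 1%:M) = (diag_mx d *t 1%:M) *m X ->
  X = \sum_i delta_mx i i *t block X i i.
Proof.
move=> dI Xd.
have X0 i a j b : i != j -> X (mxtens_index (i, a)) (mxtens_index (j, b)) = 0.
  move=> ij; have dt : diag_mx d *t 1%:M =
      diag_mx (\row_p d 0 (mxtens_unindex p).1) :> 'M[C]_(m * n).
    apply/matrixP=> p q; case: (mxtens_indexP p) => i1 a1.
    case: (mxtens_indexP q) => i2 a2; rewrite tensmxE !mxE mxtens_indexK /=.
    rewrite (can_eq (@mxtens_indexK _ _)) xpair_eqE mulr_natr -mulrnA.
    by rewrite mulnb.
  move/matrixP: Xd => /(_ (mxtens_index (i, a)) (mxtens_index (j, b))).
  rewrite dt mul_mx_diag mul_diag_mx mxE [RHS]mxE [in LHS]mxE [X in _ = X * _]mxE.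
  rewrite !mxtens_indexK /= => /eqP; rewrite mulrC -subr_eq0 -mulrBl mulf_eq0.
  by rewrite subr_eq0 (inj_eq dI) eq_sym (negPf ij) => /eqP.
apply/matrixP=> p q; case: (mxtens_indexP p) => i a; case: (mxtens_indexP q) => j b.
rewrite summxE (bigD1 i) //= tensmxE !mxE eqxx big1 ?addr0 => [|k ki].
  have [->|ij] := eqVneq i j; first by rewrite mul1r.
  by rewrite X0 // mul0r.
by rewrite tensmxE mxE eq_sym (negPf ki) mul0r.
Qed.

Lemma diag_conj_colE m (V : 'M[C]_m) i :
  V *m delta_mx i i *m V^t* = col i V *m (col i V)^t*.
Proof.
by rewrite colE adjmxM trmx_delta map_delta_mx -(mul_delta_mx (0 : 'I_1)) !mulmxA.
Qed.

(** Rotating by [V] on the first factor turns the observable diagonal; the [B i] are the diagonal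
    blocks of the rotated matrix. *)
Lemma psd_decomp_of_comm m n (A : 'M[C]_(m * n)) (d : 'rV[C]_m) (V : 'M[C]_m) :
  injective (fun i => d 0 i) -> V \is unitarymx -> psd A ->
  let K := V *m diag_mx d *m V^t* in
  A *m (K *t 1%:M) = (K *t 1%:M) *m A ->
  exists B : 'I_m -> 'M[C]_n,
    [/\ forall i, psd (B i), \sum_i \tr (B i) = \tr A &
        A = \sum_i (col i V *m (col i V)^t*) *t B i].
Proof.
move=> dI Vu Ap K AK; pose W := V *t (1%:M : 'M[C]_n).
have Wu : W \is unitarymx.
  by apply: unitary_tens => //; apply/unitarymxP; rewrite adjmx1 mulmx1.
have Wa : W^t* = V^t* *t 1%:M by rewrite adjmx_tens adjmx1.
have /unitarymxP Wu1 := Wu; have Wu2 := mul_adjmx_unitary Wu.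
pose X := W^t* *m A *m W.
have Xp : psd X by have := psd_congr (W^t*) Ap; rewrite trmxCK.
have AX : A = W *m X *m W^t*.
  by rewrite /X !mulmxA Wu1 mul1mx -mulmxA Wu1 mulmx1.
have Xd : X *m (diag_mx d *t 1%:M) = (diag_mx d *t 1%:M) *m X.
  have KW : K *t 1%:M = W *m (diag_mx d *t 1%:M) *m W^t*.
    by rewrite Wa /W !tensmx_mul !mulmx1.
  have := congr1 (fun Z => W^t* *m Z *m W) AK; rewrite KW /X !mulmxA.
  rewrite -(mulmxA _ (W^t*) W) Wu2 mulmx1 => ->.
  by rewrite mul1mx.
exists (fun i => block X i i); split=> [i||].
- exact: psd_block.
- by rewrite -mxtrace_block AX mxtrace_conj_unitary.
rewrite {1}AX {1}(block_diag_of_comm dI Xd) mulmx_sumr mulmx_suml.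
apply: eq_bigr => i _; rewrite Wa /W !tensmx_mul mul1mx mulmx1.
by rewrite diag_conj_colE.
Qed.

(** Each projector onto a column of [V] commutes with [K], of which that column is an
    eigenvector. *)
Lemma comm_of_decomp m n (A : 'M[C]_(m * n)) (d : 'rV[C]_m) (V : 'M[C]_m)
    (B : 'I_m -> 'M[C]_n) : V \is unitarymx ->
  A = \sum_i (col i V *m (col i V)^t*) *t B i ->
  let K := V *m diag_mx d *m V^t* in
  A *m (K *t 1%:M) = (K *t 1%:M) *m A.
Proof.
move=> Vu -> K; have Vu2 := mul_adjmx_unitary Vu.
rewrite mulmx_suml mulmx_sumr; apply: eq_bigr => i _.
rewrite !tensmx_mul mul1mx mulmx1 -diag_conj_colE /K !mulmxA; congr (_ *t _).
rewrite -(mulmxA _ (V^t*) V) Vu2 mulmx1 -(mulmxA _ (V^t*) V) Vu2 mulmx1.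
congr (_ *m _); rewrite -!mulmxA; congr (_ *m _).
apply/matrixP=> a b; rewrite mul_mx_diag mul_diag_mx !mxE.
by case: eqVneq => [->|_]; case: eqVneq => [->|_]; rewrite ?mulr1 ?mul1r ?mulr0 ?mul0r.
Qed.

End CommutingWithLocalObservable.

(** * Vanishing local quantum uncertainty and zero discord *)

Section Discord.
Context {R : realType}.
Local Notation C := R[i].
Local Open Scope classical_set_scope.

(** Attainment rules out the fallback value of [minimum], so [lqu] is a genuine least element. *)
Lemma lqu_attained dA dB (L : 'rV[R]_dA) (rho : 'M[C]_(dA * dB)) :
  exists K, [/\ with_spectrum L K,
    lqu L rho = skew_info rho (K *t (1%:M : 'M[C]_dB)) &
    forall K', with_spectrum L K' ->
      lqu L rho <= skew_info rho (K' *t (1%:M : 'M[C]_dB))].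
Proof.
have [K KL Kmin] := skew_info_min_attained L rho.
have E : lqu L rho = skew_info rho (K *t (1%:M : 'M[C]_dB)).
  apply: minimum_eq; first by exists K.
  by move=> _ [K' K'L <-]; apply: Kmin.
by exists K; split=> // K' K'L; rewrite E; apply: Kmin.
Qed.

Lemma lqu_local_mono dA dB (L : 'rV[R]_dA) (rho : 'M[C]_(dA * dB))
    (Phi : {linear 'M[C]_dB -> 'M[C]_dB}) :
  psdmx rho -> completely_positive Phi -> trace_preserving Phi ->
  lqu L (id_tens Phi rho) <= lqu L rho.
Proof.
(* The minimiser for [rho] competes in the minimum for the output state. *)
move=> rp cpP trP; have [K [KL E _]] := lqu_attained L rho.
have [_ [_ _ Kmin]] := lqu_attained L (id_tens Phi rho).
apply: (le_trans (Kmin K KL)); rewrite E.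
by apply: skew_info_local_mono => //; exact: with_spectrum_herm KL.
Qed.

Lemma lqu_eq0 dA dB (L : 'rV[R]_dA) (rho : 'M[C]_(dA * dB)) : psdmx rho ->
  lqu L rho = 0 <-> exists2 K, with_spectrum L K &
    rho *m (K *t 1%:M) = (K *t 1%:M) *m rho.
Proof.
move=> rp; have Kh K : with_spectrum L K ->
    (K *t (1%:M : 'M[C]_dB))^t* = K *t (1%:M : 'M[C]_dB).
  by move/with_spectrum_herm/tens_adj1; apply.
have [K [KL E Kmin]] := lqu_attained L rho; split=> [l0|[K' K'L rK']].
  exists K => //; apply/(skew_info_eq0 rp (Kh _ KL)).
  by rewrite -E.
apply/eqP; rewrite eq_le; apply/andP; split; last first.
  by rewrite E; apply: skew_info_ge0 => //; apply: Kh.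
by have := Kmin K' K'L; rewrite (proj2 (skew_info_eq0 rp (Kh _ K'L)) rK').
Qed.

Lemma real_complex_inj_row n (L : 'rV[R]_n) : injective (fun i => L 0 i) ->
  injective (fun i => map_mx (real_complex R) L 0 i).
Proof. by move=> LI i j; rewrite !mxE => /complexI/LI. Qed.

Lemma orthonormal_basis_col n (V : 'M[C]_n) :
  V \is unitarymx <-> orthonormal_basis (fun i => col i V).
Proof.
have E i j : ((col i V)^t* *m col j V) 0 0 = (V^t* *m V) i j.
  by rewrite !mxE; apply: eq_bigr => k _; rewrite !mxE.
split=> [/mul_adjmx_unitary Vu i j|Vo].
  by rewrite E Vu mxE.
apply/unitarymxP/mulmx1C/matrixP=> i j.
by rewrite -E Vo mxE.
Qed.

Lemma zero_discord_of_decomp dA dB (V : 'M[C]_dA) (rho : 'M[C]_(dA * dB))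
    (B : 'I_dA -> 'M[C]_dB) : V \is unitarymx -> \tr rho = 1 ->
  (forall i, psdmx (B i)) -> \sum_i \tr (B i) = \tr rho ->
  rho = \sum_i (col i V *m (col i V)^t*) *t B i -> zero_discord rho.
Proof.
move=> Vu tr1 Bp trB rhoE.
pose p i := complex.Re (\tr (B i)).
have trBE i : \tr (B i) = (p i)%:C.
  exact/esym/RRe_real/ger0_real/psd_tr_ge0/Bp.
have p0 i : 0 <= p i by rewrite -ler0c -trBE; exact/psd_tr_ge0/Bp.
have p1 : \sum_i p i = 1.
  apply: complexI; rewrite rmorph_sum rmorph1 -tr1 -trB.
  by apply: eq_bigr => i _; rewrite trBE.
have density_norm i : p i != 0 -> density ((p i)^-1%:C *: B i).
  move=> pi0; split; first by apply: psdZ (Bp i); rewrite ler0c invr_ge0.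
  by rewrite linearZ /= trBE -rmorphM mulVf.
(* Where the weight p_i is zero the block [B i] vanishes and cannot be normalised; the state of some
   index [j] of nonzero weight stands in for [tau i] there. *)
have [j pj] : exists j, p j != 0.
  apply/existsP; apply: contra_eqT p1 => /existsPn p00.
  by rewrite big1 ?(eq_sym 0) ?oner_eq0 // => i _; apply/eqP/negPn/p00.
exists (fun i => col i V), p,
  (fun i => if p i == 0 then (p j)^-1%:C *: B j else (p i)^-1%:C *: B i).
split=> [||i|]; first by apply/orthonormal_basis_col.
- by [].
- by case: ifPn => [_|]; apply: density_norm.
rewrite {1}rhoE; apply: eq_bigr => i _; case: ifPn => [/eqP pi0|pi0].
  have -> : B i = 0 by apply: (psd_tr_eq0 (Bp i)); rewrite trBE pi0.
  by rewrite pi0 scale0r tensmx0.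
by apply/matrixP=> a b; rewrite !mxE [RHS]mulrCA [(p i)%:C * _]mulrA -rmorphM mulfV ?mul1r.
Qed.

Lemma lqu_eq0_zero_discord dA dB (L : 'rV[R]_dA) (rho : 'M[C]_(dA * dB)) :
  injective (fun i => L 0 i) -> density rho ->
  lqu L rho = 0 <-> zero_discord rho.
Proof.
move=> LI [rp tr1]; rewrite lqu_eq0 //; split.
  move=> [_ [V [Vu ->]] rK].
  have [B [Bp trB rhoE]] := psd_decomp_of_comm (real_complex_inj_row LI) Vu rp rK.
  exact: zero_discord_of_decomp rhoE.
move=> [e [p [tau [eo _ _ rhoE]]]].
(* The discord basis forms the columns of [V], and the observable with spectrum [L] diagonal in this
   basis commutes with [rho]. *)
pose V : 'M[C]_dA := \matrix_(a, i) e i a 0.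
have Ve i : col i V = e i by apply/colP=> a; rewrite !mxE.
have Vu : V \is unitarymx.
  by apply/orthonormal_basis_col => i j; rewrite !Ve eo.
exists (V *m diag_mx (map_mx (real_complex R) L) *m V^t*); first by exists V.
suff rhoV : rho = \sum_i (col i V *m (col i V)^t*) *t ((p i)%:C *: tau i).
  exact: comm_of_decomp Vu rhoV.
rewrite {1}rhoE; apply: eq_bigr => i _; rewrite Ve.
by apply/matrixP=> a b; rewrite !mxE mulrCA.
Qed.

End Discord.

Theorem mainTheorem1 (R : realType) (dA dB : nat) (L : 'rV[R]_dA)
    (L_inj : injective (fun i => L 0 i))
    (rho : 'M[R[i]]_(dA * dB)) (rho_density : density rho) :
  [/\ forall (UA : 'M[R[i]]_dA) (UB : 'M[R[i]]_dB),
        UA \is unitarymx -> UB \is unitarymx ->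
        lqu L ((UA *t UB) *m rho *m (UA *t UB)^t*) = lqu L rho,
      forall Phi : {linear 'M[R[i]]_dB -> 'M[R[i]]_dB},
        completely_positive Phi -> trace_preserving Phi ->
        lqu L (id_tens Phi rho) <= lqu L rho
    & lqu L rho = 0 <-> zero_discord rho].
Proof.
have [rp _] := rho_density; split.
- by move=> UA UB; apply: lqu_local_unitary; exact: psd_normal.
- by move=> Phi; apply: lqu_local_mono.
- exact: lqu_eq0_zero_discord.
Qed.
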